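(* Let $\phi:[0,1]\to[0,1]$ be a Lipschitz continuous map (with Lipschitz constant $L_\phi$) and whose derivative $\phi'$ is also Lipschitz continuous (with Lipschitz constant $L_{\phi'}$), and let $\mathcal{K}$ be the associated Koopman operator, $\mathcal{K}f=f\circ\phi$. Then, for any $f\in C^1([0,1])$, an upper bound on the error in approximating $\mathcal{K}f$ by $\mathcal{B}_n\mathcal{K}f$ is given by $$\|\mathcal{B}_n\mathcal{K}f-\mathcal{K}f\|_\infty\leq \frac{1}{\sqrt{n}}\left(L_{\phi}\,\omega_{f'}\left(\frac{L_{\phi}}{2\sqrt{n}}\right)\bigg|_{[\phi(0),\phi(1)]}+\sup_{0\leq x\leq 1}|f'(\phi(x))|\,\frac{L_{\phi'}}{2\sqrt{n}}\right).$$
   Context: $C([0,1])$ (resp. $C^1([0,1])$) is the space of continuous (resp. continuously differentiable) functions on $[0,1]$, and $\|f\|_\infty=\sup_{x\in[0,1]}|f(x)|$. For $n\in\mathbb{N}$, the Bernstein operator $\mathcal{B}_n:C([0,1])\to C([0,1])$ maps $f$ to the $n$th Bernstein polynomial $\mathcal{B}_n(f;x)=\sum_{k=0}^n f(k/n)\,b_{n,k}(x)$, where $b_{n,k}(x)=\binom{n}{k}x^k(1-x)^{n-k}$. A Lipschitz constant of a function $g$ on $[0,1]$ is a constant $L_g$ such that $|g(x)-g(y)|\le L_g|x-y|$ for all $x,y\in[0,1]$. The modulus of continuity of $g\in C([0,1])$ is $\omega_g(\delta)=\sup\{|g(y)-g(x)|: |y-x|\le\delta,\ x,y\in[0,1]\}$,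 where $\delta$ is a positive number. The notation $\omega_g(\delta)|_{[\phi(0),\phi(1)]}$ denotes the modulus of continuity of $g$ evaluated over $[\phi(0),\phi(1)]\subseteq[0,1]$, i.e. with $x,y$ restricted to $[\phi(0),\phi(1)]$.
   Formalization: The modulus of continuity of f' is taken over the range φ([0,1]) instead of [φ(0),φ(1)]; they agree when φ stays between φ(0) and φ(1), and otherwise the bound can fail, e.g. φ(x)=4x(1−x), f(y)=|y−1/2|^{3/2}, n large. *)

(* Defs.v *)
From HB Require Import structures.
From mathcomp Require Import all_boot all_order all_algebra.
From mathcomp Require Import all_classical all_reals all_analysis.
Set Implicit Arguments.
Unset Strict Implicit.
Unset Printing Implicit Defensive.
Import Order.TTheory GRing.Theory Num.Theory.
Import numFieldNormedType.Exports.
Local Open Scope classical_set_scope.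
Local Open Scope ring_scope.

(* Functions on [0,1] are represented by total functions R -> R; every notion
   below depends only on their values on [0,1]. *)
Definition unit_itv (R : realType) : set R := `[0, 1]%classic.
Arguments unit_itv : clear implicits.

Definition bernstein_basis (R : realType) (n k : nat) (x : R) : R :=
  'C(n, k)%:R * x ^+ k * (1 - x) ^+ (n - k).

Definition bernstein (R : realType) (n : nat) (f : R -> R) : R -> R :=
  fun x => \sum_(k < n.+1) f (k%:R / n%:R) * bernstein_basis n k x.

Definition koopman (R : realType) (phi f : R -> R) : R -> R := f \o phi.

(* The real-valued [sup] is 0 on unbounded sets; the suprema below are meant for
   functions that are bounded on the set considered, for instance continuous
   functions on [0,1]. *)
Definition sup_norm (R : realType) (f : R -> R) : R :=
  sup [set `|f x| | x in unit_itv R].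

Definition modulus (R : realType) (A : set R) (g : R -> R) (delta : R) : R :=
  sup [set `|g p.2 - g p.1| | p in [set p : (R * R)%type |
         [/\ A p.1, A p.2 & `|p.2 - p.1| <= delta]]].

(* The difference quotient is restricted to points of [0,1], so the derivative
   is one-sided at 0 and at 1. *)
Definition diff_quot (R : realType) (f : R -> R) (x : R) : R -> R :=
  fun y => (f y - f x) / (y - x).

Definition derivable01 (R : realType) (f : R -> R) : Prop :=
  forall x, unit_itv R x -> cvg (diff_quot f x @ within (unit_itv R) x^').

Definition deriv01 (R : realType) (f : R -> R) (x : R) : R :=
  lim (diff_quot f x @ within (unit_itv R) x^').

Definition C1_01 (R : realType) (f : R -> R) : Prop :=
  derivable01 f /\ {within unit_itv R, continuous (deriv01 f)}.

(* The interval of values of phi. It is [phi 0, phi 1] as soon as phi takes its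
   values between phi 0 and phi 1, see [value_itvE]; without that proviso the
   interval with these endpoints can miss values of phi, and can even be reduced
   to a point (phi x = 4x(1-x)) or be empty (phi x = 1-x). *)
Definition value_itv (R : realType) (phi : R -> R) : set R :=
  phi @` unit_itv R.

Lemma value_itvE (R : realType) (phi : R -> R) :
  {within unit_itv R, continuous phi} ->
  (forall x, unit_itv R x -> phi 0 <= phi x <= phi 1) ->
  value_itv phi = `[phi 0, phi 1]%classic.
Proof.
move=> phic phib; apply/seteqP; split => [_ [x x01 <-]|y].
  by rewrite /= in_itv /=; exact: phib.
rewrite /= in_itv /= => /andP[y0 y1].
have [|c c01 <-] := @IVT R phi 0 1 y ler01 phic.
  by rewrite ge_min y0 le_max y1 orbT.
by exists c.
Qed.

(* Main.v *)
(** Put g = f o phi, with g' = (f' o phi) phi', and t = |y - x|. By the mean value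
theorem g y - g x = g'(c) (y - x), and
  g'(c) - g'(x) = phi'(c) (f'(phi c) - f'(phi x)) + f'(phi x) (phi'(c) - phi'(x)).
With d = 1 / (2 sqrt n) and w = omega_f'(L_phi d), cutting [x, c] into steps of
length at most d bounds the first term by L_phi (1 + t / d) w, so
  |g y - g x - g'(x) (y - x)| <= L_phi w t + (L_phi w / d + S L_phi') t^2,
where S = sup |f' o phi|. The operator B_n is positive and reproduces affine
functions, its second central moment is at most 1 / (4 n) and its first absolute
central moment at most 1 / (2 sqrt n): applying it in y gives the bound. *)

Require Import Defs.
From HB Require Import structures.
From mathcomp Require Import all_boot all_order all_algebra.
From mathcomp Require Import all_classical all_reals all_analysis.
From mathcomp Require Import ring lra.
Import Order.TTheory GRing.Theory Num.Theory.
Import numFieldNormedType.Exports.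
Local Open Scope classical_set_scope.
Local Open Scope ring_scope.

(** * Moments and positivity of the Bernstein operator *)

(** Pascal's rule, or conditioning a binomial variable on one of its trials. The weight [h] is
    arbitrary so that each moment below follows by induction on [n]. *)
Lemma bernstein_basis_recr {R : realType} (n : nat) (h : nat -> R) (x : R) :
  \sum_(k < n.+2) h k * bernstein_basis n.+1 k x =
  x * (\sum_(k < n.+1) h k.+1 * bernstein_basis n k x)
  + (1 - x) * (\sum_(k < n.+1) h k * bernstein_basis n k x).
Proof.
have -> : (1 - x) * (\sum_(k < n.+1) h k * bernstein_basis n k x) =
    \sum_(k < n.+2) h k * ('C(n, k)%:R * x ^+ k * (1 - x) ^+ (n.+1 - k)).
  rewrite [in RHS]big_ord_recr /= bin_small// !mul0r mulr0 addr0 mulr_sumr.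
  apply: eq_bigr => -[k /= kn] _.
  by rewrite /bernstein_basis subSn// exprS; ring.
rewrite [LHS]big_ord_recl [X in _ = _ + X]big_ord_recl addrCA mulr_sumr -big_split /=.
congr (_ + _); first by rewrite /bernstein_basis !bin0.
apply: eq_bigr => -[k /= kn] _.
by rewrite /bernstein_basis /bump/= add1n binS natrD subSS exprS; ring.
Qed.

Lemma sum_bernstein_basis {R : realType} (n : nat) (x : R) :
  \sum_(k < n.+1) bernstein_basis n k x = 1.
Proof.
have -> : \sum_(k < n.+1) bernstein_basis n k x =
    \sum_(k < n.+1) 1 * bernstein_basis n k x.
  by apply: eq_bigr => k _; rewrite mul1r.
elim: n => [|n ih].
  by rewrite big_ord1 /bernstein_basis bin0 !expr0 !mulr1.
by rewrite (bernstein_basis_recr _ (fun=> 1)) ih; ring.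
Qed.

(** The centre [c] is left free because the recurrence shifts the index: [k.+1 - c] is
    [k - (c - 1)], so the induction hypothesis is used at [c] and at [c - 1]. *)
Lemma bernstein_basis_mean {R : realType} (n : nat) (x c : R) :
  \sum_(k < n.+1) (k%:R - c) * bernstein_basis n k x = n%:R * x - c.
Proof.
elim: n c => [|n ih] c.
  by rewrite big_ord1 /bernstein_basis bin0 !expr0 !mulr1 mul0r.
rewrite (bernstein_basis_recr _ (fun k => k%:R - c)) ih.
have -> : \sum_(k < n.+1) (k.+1%:R - c) * bernstein_basis n k x =
    \sum_(k < n.+1) (k%:R - (c - 1)) * bernstein_basis n k x.
  by apply: eq_bigr => k _; rewrite -natr1; ring.
by rewrite ih -natr1; ring.
Qed.

(** Binomial variance plus squared bias, by the same induction with a moving centre. *)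
Lemma bernstein_basis_variance {R : realType} (n : nat) (x c : R) :
  \sum_(k < n.+1) (k%:R - c) ^+ 2 * bernstein_basis n k x =
  n%:R * x * (1 - x) + (n%:R * x - c) ^+ 2.
Proof.
elim: n c => [|n ih] c.
  by rewrite big_ord1 /bernstein_basis /= bin0 !expr0; ring.
rewrite (bernstein_basis_recr _ (fun k => (k%:R - c) ^+ 2)) ih.
have -> : \sum_(k < n.+1) (k.+1%:R - c) ^+ 2 * bernstein_basis n k x =
    \sum_(k < n.+1) (k%:R - (c - 1)) ^+ 2 * bernstein_basis n k x.
  by apply: eq_bigr => k _; rewrite -natr1; ring.
by rewrite ih -natr1; ring.
Qed.

Lemma bernstein_basis_ge0 {R : realType} (n k : nat) (x : R) :
  unit_itv R x -> 0 <= bernstein_basis n k x.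
Proof.
rewrite /unit_itv /= in_itv /= => /andP[x0 x1].
by rewrite /bernstein_basis !mulr_ge0 ?exprn_ge0 ?subr_ge0.
Qed.

(** Combines the moments of order 0 and 1. The affine map is centred at [x] because it will be the
    tangent of [f \o phi] there. *)
Lemma bernstein_affine {R : realType} (n : nat) (x c d : R) : (0 < n)%N ->
  bernstein n (fun y => c + d * (y - x)) x = c.
Proof.
move=> n0; have nn0 : n%:R != 0 :> R by rewrite pnatr_eq0 -lt0n.
rewrite /bernstein.
have -> : \sum_(k < n.+1) (c + d * (k%:R / n%:R - x)) * bernstein_basis n k x =
   c * (\sum_(k < n.+1) bernstein_basis n k x) +
   d / n%:R * (\sum_(k < n.+1) (k%:R - n%:R * x) * bernstein_basis n k x).
  rewrite !mulr_sumr -big_split /=; apply: eq_bigr => k _; field.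
  exact: nn0.
by rewrite sum_bernstein_basis bernstein_basis_mean; ring.
Qed.

Lemma bernstein_sqr_le {R : realType} (n : nat) (x : R) : (0 < n)%N ->
  bernstein n (fun y => (y - x) ^+ 2) x <= (4 * n%:R)^-1.
Proof.
move=> n0; have np : 0 < n%:R :> R by rewrite ltr0n.
rewrite /bernstein.
have -> : \sum_(k < n.+1) (k%:R / n%:R - x) ^+ 2 * bernstein_basis n k x =
   n%:R ^- 2 * (\sum_(k < n.+1) (k%:R - n%:R * x) ^+ 2 * bernstein_basis n k x).
  rewrite !mulr_sumr; apply: eq_bigr => k _; field.
  exact: lt0r_neq0.
rewrite bernstein_basis_variance subrr expr0n/= addr0.
have -> : n%:R ^- 2 * (n%:R * x * (1 - x)) = n%:R^-1 * (x * (1 - x)).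
  by field; exact: lt0r_neq0.
rewrite invfM mulrC ler_wpM2r ?invr_ge0 ?ler0n//.
(* The square gives x (1 - x) <= 1/4. *)
by have := sqr_ge0 (x - 2^-1); rewrite expr2; nra.
Qed.

Lemma ler_bernstein {R : realType} {n : nat} {f g : R -> R} {x : R} :
  (0 < n)%N -> unit_itv R x -> (forall y, unit_itv R y -> f y <= g y) ->
  bernstein n f x <= bernstein n g x.
Proof.
move=> n0 x01 fg; apply: ler_sum => -[k /= kn] _.
rewrite ler_wpM2r ?bernstein_basis_ge0// fg// /unit_itv /= in_itv /=.
by rewrite divr_ge0//= ler_pdivrMr ?ltr0n// mul1r ler_nat -ltnS.
Qed.

Lemma bernsteinD {R : realType} (n : nat) (f g : R -> R) (x : R) :
  bernstein n (fun y => f y + g y) x = bernstein n f x + bernstein n g x.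
Proof. by rewrite -big_split; apply: eq_bigr => k _; rewrite mulrDl. Qed.

Lemma bernsteinZ {R : realType} (n : nat) (c : R) (f : R -> R) (x : R) :
  bernstein n (fun y => c * f y) x = c * bernstein n f x.
Proof. by rewrite mulr_sumr; apply: eq_bigr => k _; rewrite mulrA. Qed.

Lemma bernstein_cst {R : realType} (n : nat) (c x : R) :
  bernstein n (fun=> c) x = c.
Proof. by rewrite /bernstein -mulr_sumr sum_bernstein_basis mulr1. Qed.

(* The inequality is AM-GM at the scale sqrt n, [|t| <= sqrt n t^2 + 1 / (4 sqrt n)],
   averaged over the Bernstein weights. *)
Lemma bernstein_dist_le {R : realType} (n : nat) (x : R) : (0 < n)%N ->
  unit_itv R x ->
  bernstein n (fun y => `|y - x|) x <= (2 * Num.sqrt n%:R)^-1.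
Proof.
move=> n0 x01; set s := Num.sqrt n%:R.
have s0 : 0 < s by rewrite sqrtr_gt0 ltr0n.
have ns : n%:R = s ^+ 2 by rewrite sqr_sqrtr.
have amgm y : `|y - x| <= s * (y - x) ^+ 2 + (4 * s)^-1.
  rewrite -[(y - x) ^+ 2]real_normK ?num_real//; set t := `|y - x|.
  rewrite -subr_ge0.
  have -> : s * t ^+ 2 + (4 * s)^-1 - t = s * (t - (2 * s)^-1) ^+ 2.
    by field; exact: lt0r_neq0.
  by rewrite mulr_ge0 ?sqr_ge0 ?ltW.
apply: (le_trans (ler_bernstein n0 x01 (fun y _ => amgm y))).
rewrite bernsteinD bernsteinZ bernstein_cst.
have := bernstein_sqr_le n x n0; rewrite ns => v.
apply: (@le_trans _ _ (s * (4 * s ^+ 2)^-1 + (4 * s)^-1)).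
  by rewrite lerD2r ler_pM2l.
by rewrite le_eqVlt; apply/orP; left; apply/eqP; field; exact: lt0r_neq0.
Qed.

(** * Derivatives relative to a set *)

(* A first-order expansion form of the derivative, which composes without
   dividing by an increment [phi y - phi x] that may vanish. *)
Definition deriv_on {R : realType} (A : set R) (f : R -> R) (x a : R) : Prop :=
  forall e, 0 < e ->
  \forall y \near x, A y -> `|f y - f x - a * (y - x)| <= e * `|y - x|.

Lemma derivable01_deriv_on {R : realType} {f : R -> R} {x : R} :
  derivable01 f -> unit_itv R x -> deriv_on (unit_itv R) f x (deriv01 f x).
Proof.
move=> fd x01 e e0.
have /cvgrPdist_le /(_ e e0) : diff_quot f x @ within (unit_itv R) x^' --> deriv01 f x.
  exact: fd.
rewrite near_withinE near_withinE; apply: filterS => y + y01.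
have [-> _|yx /(_ isT y01)] := eqVneq y x.
  by rewrite !subrr mulr0 subrr normr0 mulr0.
have yx0 : y - x != 0 by rewrite subr_eq0.
rewrite /diff_quot -(ler_pM2r (x := `|y - x|)) ?normr_gt0// -normrM mulrBl divfK//.
by rewrite distrC.
Qed.

(** Chain rule. The Lipschitz bound on [g] at [x] serves twice: it brings [g y] into the ball where
    the expansion of [f] holds, and it turns an error in [|g y - g x|] into one in [|y - x|]. *)
Lemma deriv_on_comp {R : realType} {A B : set R} {f g : R -> R} {x a b L : R} :
  (forall y, A y -> B (g y)) ->
  (forall y, A y -> `|g y - g x| <= L * `|y - x|) ->
  deriv_on B f (g x) a -> deriv_on A g x b ->
  deriv_on A (f \o g) x (a * b).
Proof.
move=> AB gL fa gb e e0.
have K0 : 0 < `|L| + `|a| + 1 by rewrite ltr_wpDl ?addr_ge0.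
(* The expansion of [f] costs [d * |L|] and that of [g] costs [|a| * d]; the added 1 keeps the
   denominator positive. *)
pose d := e / (`|L| + `|a| + 1).
have d0 : 0 < d by rewrite divr_gt0.
have [r /= r0 fr] := (iffLR (@nbhs_ballP _ _ _ _) (fa d d0)).
have : \forall y \near x, `|y - x| < r / (`|L| + 1).
  apply/nbhs_ballP; exists (r / (`|L| + 1)) => /=; first by rewrite divr_gt0// ltr_wpDl.
  by move=> y; rewrite /ball /= distrC.
apply: filterS2 (gb d d0) => y gy yr Ay.
have {}gy := gy Ay; have gLy := gL y Ay.
have gLy' : `|g y - g x| <= `|L| * `|y - x|.
  by apply: (le_trans gLy); rewrite ler_wpM2r// ler_norm.
have : `|f (g y) - f (g x) - a * (g y - g x)| <= d * `|g y - g x|.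
  apply: fr; last exact: AB.
  rewrite /ball /= distrC (le_lt_trans gLy')//.
  move: yr; rewrite ltr_pdivlMr ?ltr_wpDl//; apply: le_lt_trans.
  by rewrite mulrC ler_wpM2l// lerDl.
move=> fy /=.
have -> : f (g y) - f (g x) - a * b * (y - x) =
  (f (g y) - f (g x) - a * (g y - g x)) + a * (g y - g x - b * (y - x)) by ring.
apply: (le_trans (ler_normD _ _)); rewrite normrM.
have -> : e = d * (`|L| + `|a| + 1) by rewrite divfK// lt0r_neq0.
have := normr_ge0 (y - x); have := normr_ge0 a.
move: fy gLy' gy; move: (`|f _ - _ - _|) (`|g y - g x|) (`|y - x|) (`|a|) (`|L|) => p q t a' l.
move: (`|g y - _ - _|) => r' h1 h2 h3 a0 t0.
have : a' * r' <= a' * (d * t) by rewrite ler_wpM2l.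
have : d * q <= d * (l * t) by rewrite ler_pM2l.
have : 0 <= d * t by rewrite mulr_ge0// ltW.
lra.
Qed.

Lemma deriv_on_continuous {R : realType} {A : set R} {f : R -> R} {x a : R} :
  deriv_on A f x a -> f @ within A (nbhs x) --> f x.
Proof.
move=> fa; apply/cvgrPdist_le => e e0; rewrite near_withinE.
have : \forall y \near x, `|y - x| < e / (`|a| + 1).
  apply/nbhs_ballP; exists (e / (`|a| + 1)) => /=; first by rewrite divr_gt0// ltr_wpDl.
  by move=> y; rewrite /ball /= distrC.
apply: filterS2 (fa 1 ltr01) => y fy ye Ay.
rewrite distrC.
have -> : f y - f x = (f y - f x - a * (y - x)) + a * (y - x) by ring.
apply: (le_trans (ler_normD _ _)); rewrite normrM.
have := fy Ay; move: ye; rewrite ltr_pdivlMr ?ltr_wpDl//; lra.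
Qed.

(** At an interior point the relative derivative is the ordinary one, which opens the way to
    [MVT]. *)
Lemma deriv_on_is_derive {R : realType} (A : set R) {f : R -> R} {x a : R} :
  nbhs x A -> deriv_on A f x a -> is_derive x 1 f a.
Proof.
move=> xA fa.
have c : (fun h => h^-1 *: ((f \o shift x) (h *: 1) - f x)) @ 0^' --> a.
  apply/cvgrPdist_le => e e0; rewrite near_withinE.
  have : \forall y \near x, `|f y - f x - a * (y - x)| <= e * `|y - x|.
    by apply: filterS2 (fa e e0) xA => y; apply.
  rewrite (near_shift 0) subr0; apply: filterS => h /=.
  rewrite /= addrK => fh h0.
  rewrite -(ler_pM2r (x := `|h|)) ?normr_gt0// -normrM.
  rewrite [_ *: 1]mulr1 -[leLHS]normrN; set df := _ *: _.
  suff -> : - ((a - df) * h) = f (h + x) - f x - a * h.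
    exact: fh.
  by rewrite /df [_ *: _]mulrC mulrBl divfK// opprB.
by split; [apply/cvg_ex; exists a | exact/cvg_lim].
Qed.

(** A single increment, from [x] to a nearby [x + r / 2] in [A], already gives [|a| <= L + e]. *)
Lemma deriv_on_norm_le {R : realType} {A : set R} {f : R -> R} {x a L : R} :
  nbhs x A -> (forall y, A y -> `|f y - f x| <= L * `|y - x|) ->
  deriv_on A f x a -> `|a| <= L.
Proof.
move=> xA fL fa; apply/ler_addgt0Pr => e e0.
have /nbhs_ballP[r /= r0 xr] : nbhs x (A `&` [set y | `|f y - f x - a * (y - x)| <= e * `|y - x|]).
  by apply: filterS2 (fa e e0) xA => y h Ay; split=> //; exact: h.
have [Ay /= fy] : (A `&` [set y | `|f y - f x - a * (y - x)| <= e * `|y - x|]) (x + r / 2).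
  by apply: xr; rewrite /ball /= opprD addrA subrr sub0r normrN gtr0_norm; lra.
move: (fL _ Ay) fy; have -> : x + r / 2 - x = r / 2 by ring.
have r2 : 0 < r / 2 by rewrite divr_gt0.
rewrite (gtr0_norm r2) => h1 h2; rewrite -(ler_pM2r (x := r / 2))// -{1}(gtr0_norm r2) -normrM.
have -> : a * (r / 2) = (f (x + r / 2) - f x) - (f (x + r / 2) - f x - a * (r / 2)).
  by ring.
by apply: (le_trans (ler_normB _ _)); lra.
Qed.

(** Ordinary derivatives are used only strictly between [x] and [y], hence inside ]0, 1[; at the
    endpoints the one-sided expansion supplies continuity. *)
Lemma deriv_on_MVT {R : realType} {f df : R -> R} {x y : R} :
  (forall z, unit_itv R z -> deriv_on (unit_itv R) f z (df z)) ->
  unit_itv R x -> unit_itv R y -> x < y ->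
  exists2 c, x < c < y & f y - f x = df c * (y - x).
Proof.
move=> fd; rewrite /unit_itv /= !in_itv /= => /andP[x0 x1] /andP[y0 y1] xy.
have [||c cxy e] := @MVT R f df x y xy; last by exists c; rewrite // in_itv in cxy.
  move=> z; rewrite in_itv /= => /andP[xz zy].
  have z01 : 0 < z < 1 by rewrite (le_lt_trans x0 xz) (lt_le_trans zy y1).
  apply: (deriv_on_is_derive (unit_itv R)).
    have : (unit_itv R)° z by rewrite /unit_itv interior_itv_bnd /= in_itv.
    exact.
  by apply: fd; case/andP: z01 => *; rewrite /unit_itv /= in_itv /= !ltW.
apply: (@continuous_subspaceW _ _ _ (unit_itv R)).
  move=> z; rewrite /unit_itv /= !in_itv /= => /andP[xz zy].
  by rewrite (le_trans x0 xz) (le_trans zy y1).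
by apply/subspace_continuousP => z z01; apply: deriv_on_continuous; exact: fd.
Qed.

(** * Oscillation estimates on the unit interval *)

(** Cut the segment from [a] to [b] into m + 1 equal steps of length at most [d], where m is the
    integer part of [|a - b| / d], and add up the oscillations. *)
Lemma dist_le_subdivision {R : realType} (h : R -> R) (d w : R) : 0 < d ->
  (forall a b, unit_itv R a -> unit_itv R b -> `|a - b| <= d ->
     `|h a - h b| <= w) ->
  forall a b, unit_itv R a -> unit_itv R b ->
     `|h a - h b| <= (1 + `|a - b| / d) * w.
Proof.
move=> d0 hd a b a01 b01.
have w0 : 0 <= w by apply: le_trans (hd a a a01 a01 _); rewrite ?subrr ?normr0// ltW.
have steps m u v : unit_itv R u -> unit_itv R v -> `|u - v| <= m.+1%:R * d ->
    `|h u - h v| <= m.+1%:R * w.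
  elim: m u v => [|m ih] u v u01 v01 uv.
    by rewrite mul1r; apply: hd => //; rewrite mul1r in uv.
  have m2 : 0 < m.+2%:R :> R by rewrite ltr0n.
  have m12 : m.+2%:R = m.+1%:R + 1 :> R by rewrite natr1.
  have m1 : 0 <= m.+1%:R :> R by rewrite ler0n.
  (* [z] is one step away from [u], leaving [m.+1] steps to [v]; as a convex combination it stays in
     [0, 1]. *)
  pose z := v + (u - v) * (m.+1%:R / m.+2%:R).
  have zv : z - v = (u - v) / m.+2%:R * m.+1%:R by rewrite /z; ring.
  have uz : u - z = (u - v) / m.+2%:R.
    by rewrite /z; move: (m.+2%:R : R) (m.+1%:R : R) m12 m2 => k l -> k0; field; exact: lt0r_neq0.
  have uvd : `|(u - v) / m.+2%:R| <= d.
    by rewrite normrM normfV (gtr0_norm m2) ler_pdivrMr// mulrC.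
  have z01 : unit_itv R z.
    have l0 : 0 <= m.+1%:R / m.+2%:R :> R by rewrite divr_ge0// ltW.
    have l1 : m.+1%:R / m.+2%:R <= 1 :> R by rewrite ler_pdivrMr// mul1r m12 lerDl.
    move: u01 v01; rewrite /z /unit_itv /= !in_itv /=.
    move: (_ / _) l0 l1 => l l0 l1 /andP[? ?] /andP[? ?].
    by apply/andP; split; nra.
  have -> : h u - h v = (h u - h z) + (h z - h v) by ring.
  rewrite m12 mulrDl mul1r [leRHS]addrC; apply: (le_trans (ler_normD _ _)).
  apply: lerD; first by apply: hd => //; rewrite uz.
  by apply: ih => //; rewrite zv normrM (ger0_norm m1) mulrC ler_wpM2l.
have t0 : 0 <= `|a - b| / d by rewrite divr_ge0// ltW.
have /andP[tm tM] := truncn_itv t0.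
apply: (le_trans (steps (Num.truncn (`|a - b| / d)) a b a01 b01 _)).
  by rewrite -ler_pdivrMr// ltW.
by rewrite ler_wpM2r// -natr1 addrC lerD2l.
Qed.

(** By compactness. Such bounds are what make the real-valued [sup] an actual upper bound of its
    set. *)
Lemma within_continuous_bounded {R : realType} (h : R -> R) :
  {within unit_itv R, continuous h} ->
  exists M, forall x, unit_itv R x -> `|h x| <= M.
Proof.
move=> hc; have /compact_bounded[M [_ hM]] :=
  continuous_compact hc (@segment_compact R 0 1).
exists (M + 1) => x x01; apply: (hM (M + 1)); first by rewrite ltrDl.
by exists x.
Qed.

Lemma le_modulus {R : realType} (A : set R) (h : R -> R) (M d x y : R) :
  (forall z, A z -> `|h z| <= M) -> A x -> A y -> `|y - x| <= d ->
  `|h y - h x| <= modulus A h d.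
Proof.
move=> hM Ax Ay yx; apply: ub_le_sup; last by exists (x, y).
exists (M + M) => _ [[u v] /= [Au Av _] <-].
by apply: (le_trans (ler_normB _ _)); apply: lerD; exact: hM.
Qed.

(** * First-order remainder of [f \o phi] and its Bernstein average *)

Theorem theorem4p2 (R : realType) (phi : R -> R) (Lphi Lphi' : R)
    (phi01 : forall x, unit_itv R x -> unit_itv R (phi x))
    (phi_lip : Lphi.-lipschitz_(unit_itv R) phi)
    (phi_der : derivable01 phi)
    (phi'_lip : Lphi'.-lipschitz_(unit_itv R) (deriv01 phi))
    (f : R -> R) (f_C1 : C1_01 f) (n : nat) (n_gt0 : (0 < n)%N) :
  sup_norm (fun x => bernstein n (koopman phi f) x - koopman phi f x)
  <= (Num.sqrt n%:R)^-1 *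
     (Lphi * modulus (value_itv phi) (deriv01 f) (Lphi / (2 * Num.sqrt n%:R))
      + sup [set `|deriv01 f (phi x)| | x in unit_itv R]
        * (Lphi' / (2 * Num.sqrt n%:R))).
Proof.
have [f_der f'_cont] := f_C1.
have {}phi_lip x y : unit_itv R x -> unit_itv R y ->
    `|phi y - phi x| <= Lphi * `|y - x|.
  by move=> x01 y01; exact: (phi_lip (y, x) (conj y01 x01)).
have {}phi'_lip x y : unit_itv R x -> unit_itv R y ->
    `|deriv01 phi y - deriv01 phi x| <= Lphi' * `|y - x|.
  by move=> x01 y01; exact: (phi'_lip (y, x) (conj y01 x01)).
have in0 : unit_itv R 0 by rewrite /unit_itv /= in_itv /= lexx ler01.
have in1 : unit_itv R 1 by rewrite /unit_itv /= in_itv /= lexx ler01.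
(* The points 0 and 1, at distance 1, force the Lipschitz constant to be nonnegative. *)
have Lphi0 : 0 <= Lphi.
  by have := le_trans (normr_ge0 _) (phi_lip 0 1 in0 in1); rewrite subr0 normr1 mulr1.
have Lphi'0 : 0 <= Lphi'.
  by have := le_trans (normr_ge0 _) (phi'_lip 0 1 in0 in1); rewrite subr0 normr1 mulr1.
have [M f'M] := within_continuous_bounded (deriv01 f) f'_cont.
set s := Num.sqrt n%:R.
have s0 : 0 < s by rewrite sqrtr_gt0 ltr0n.
have ns : n%:R = s ^+ 2 by rewrite sqr_sqrtr.
set w := modulus _ _ _; set S := sup _.
have S_ub x : unit_itv R x -> `|deriv01 f (phi x)| <= S.
  move=> x01; apply: ub_le_sup; last by exists x.
  by exists M => _ [y y01 <-]; apply: f'M; exact: phi01.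
have S0 : 0 <= S := le_trans (normr_ge0 _) (S_ub 0 in0).
have d0 : 0 < (2 * s)^-1 by rewrite invr_gt0 mulr_gt0.
have w_ub x y : unit_itv R x -> unit_itv R y -> `|y - x| <= (2 * s)^-1 ->
    `|deriv01 f (phi y) - deriv01 f (phi x)| <= w.
  move=> x01 y01 yx; apply: (le_modulus _ _ M).
  - by move=> _ [z z01 <-]; apply: f'M; exact: phi01.
  - by exists x.
  - by exists y.
  - by apply: (le_trans (phi_lip _ _ x01 y01)); rewrite ler_wpM2l.
have w0 : 0 <= w.
  by apply: le_trans (w_ub 0 0 in0 in0 _); rewrite ?subrr ?normr0// ltW.
have f'phi_dist x y : unit_itv R x -> unit_itv R y ->
    `|deriv01 f (phi y) - deriv01 f (phi x)| <= (1 + `|y - x| * (2 * s)) * w.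
  move=> x01 y01; rewrite -[2 * s]invrK.
  (* The subdivision takes place in the source interval, so that [deriv01 f] is only compared at
     values of [phi], as in [w]. *)
  apply: (dist_le_subdivision (deriv01 f \o phi) _ _ d0) => //.
  by move=> a b a01 b01; exact: w_ub.
pose g := koopman phi f.
pose g' x := deriv01 f (phi x) * deriv01 phi x.
have g_der x : unit_itv R x -> deriv_on (unit_itv R) g x (g' x).
  move=> x01; apply: (deriv_on_comp phi01 (fun y => phi_lip x y x01)).
    by apply: derivable01_deriv_on => //; exact: phi01.
  exact: derivable01_deriv_on.
(* Stated for interior points, which have a neighbourhood inside [0, 1]; the mean value points are
   of this kind. *)
have phi'_le c : 0 < c < 1 -> `|deriv01 phi c| <= Lphi.
  move=> c01; have c01' : (unit_itv R)° c.
    by rewrite /unit_itv interior_itv_bnd /= in_itv.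
  have c01'' := nbhs_singleton c01'.
  apply: (deriv_on_norm_le c01' (fun y => phi_lip c y c01'')).
  exact: derivable01_deriv_on.
have g'_dist x c t : unit_itv R x -> 0 < c < 1 -> `|c - x| <= t ->
    `|g' c - g' x| <= Lphi * ((1 + t * (2 * s)) * w) + S * (Lphi' * t).
  move=> x01 c01 cx.
  have c01' : unit_itv R c.
    by rewrite /unit_itv /= in_itv /=; case/andP: c01 => *; rewrite !ltW.
  (* The factor [deriv01 phi] is taken at the interior point [c], where [phi'_le] applies. *)
  have -> : g' c - g' x =
      deriv01 phi c * (deriv01 f (phi c) - deriv01 f (phi x))
      + deriv01 f (phi x) * (deriv01 phi c - deriv01 phi x) by rewrite /g'; ring.
  apply: (le_trans (ler_normD _ _)); rewrite !normrM lerD//.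
    rewrite ler_pM ?phi'_le//; apply: (le_trans (f'phi_dist _ _ x01 c01')).
    by rewrite ler_wpM2r// lerD2l ler_wpM2r// mulr_ge0// ltW.
  rewrite ler_pM ?S_ub//; apply: (le_trans (phi'_lip _ _ x01 c01')).
  by rewrite ler_wpM2l.
have g_taylor x y : unit_itv R x -> unit_itv R y ->
    `|g y - (g x + g' x * (y - x))| <=
    Lphi * w * `|y - x| + (2 * s * Lphi * w + S * Lphi') * (y - x) ^+ 2.
  move=> x01 y01; have [->|yx] := eqVneq y x.
    by rewrite !subrr mulr0 addr0 subrr normr0 expr0n/= !mulr0 addr0.
  have [c [c01 cx e]] : exists c,
      [/\ 0 < c < 1, `|c - x| <= `|y - x| & g y - g x = g' c * (y - x)].
    have := (x01, y01); rewrite /unit_itv /= !in_itv /= => -[/andP[x0 x1] /andP[y0 y1]].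
    have [lyx|lxy] : y < x \/ x < y by apply/orP; rewrite -neq_lt.
      have [c /andP[yc cx] e] := deriv_on_MVT g_der y01 x01 lyx.
      exists c; split.
      - by rewrite (le_lt_trans y0 yc) (lt_le_trans cx x1).
      - by rewrite !ltr0_norm ?subr_lt0// lerN2 lerD2r ltW.
      - by rewrite -opprB e -mulrN opprB.
    have [c /andP[xc cy] e] := deriv_on_MVT g_der x01 y01 lxy.
    exists c; split => //.
    - by rewrite (le_lt_trans x0 xc) (lt_le_trans cy y1).
    - by rewrite !gtr0_norm ?subr_gt0// lerD2r ltW.
  rewrite -[(y - x) ^+ 2]real_normK ?num_real//.
  have -> : g y - (g x + g' x * (y - x)) = (g' c - g' x) * (y - x).
    by rewrite opprD addrA e; ring.
  rewrite normrM; set t := `|y - x|.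
  have -> : Lphi * w * t + (2 * s * Lphi * w + S * Lphi') * t ^+ 2 =
     (Lphi * ((1 + t * (2 * s)) * w) + S * (Lphi' * t)) * t by ring.
  by apply: ler_wpM2r; [exact: normr_ge0|exact: g'_dist].
(* Bounding a supremum from above requires a nonempty set, hence the witness at 0. *)
apply: ge_sup; first by exists `|bernstein n g 0 - g 0|; exists 0.
move=> _ [x x01 <-]; rewrite -/g.
set K := 2 * s * Lphi * w + S * Lphi'.
have K0 : 0 <= K by rewrite addr_ge0 ?mulr_ge0// ltW.
pose B y := Lphi * w * `|y - x| + K * (y - x) ^+ 2.
have B_le : bernstein n B x <= Lphi * w * (2 * s)^-1 + K * (4 * s ^+ 2)^-1.
  rewrite bernsteinD !bernsteinZ lerD// ler_wpM2l ?mulr_ge0//.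
    exact: bernstein_dist_le.
  by rewrite -ns; exact: bernstein_sqr_le.
(* [g x] is the Bernstein value at [x] of the tangent of [g]; positivity transfers each side of
   [g_taylor] to the operator. *)
have up : bernstein n g x <= g x + bernstein n B x.
  rewrite -{1}(bernstein_affine n x (g x) (g' x) n_gt0) -bernsteinD.
  apply: ler_bernstein => // y y01.
  by rewrite -lerBlDl; apply: le_trans (g_taylor x y x01 y01); exact: ler_norm.
have lo : g x <= bernstein n g x + bernstein n B x.
  rewrite -{1}(bernstein_affine n x (g x) (g' x) n_gt0) -bernsteinD.
  apply: ler_bernstein => // y y01.
  by rewrite -lerBlDl; apply: le_trans (g_taylor x y x01 y01); rewrite distrC; exact: ler_norm.
have {up lo} : `|bernstein n g x - g x| <= bernstein n B x.
  by rewrite ler_norml; apply/andP; split; lra.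
move=> /le_trans -> //; apply: (le_trans B_le).
rewrite -subr_ge0.
(* The first moment and the [w] part of [K] each give Lphi w / (2 s), together exactly the first
   term. The rest of [K] gives S Lphi' / (4 s^2), half of the second term, and the other half is the
   slack. *)
have -> : s^-1 * (Lphi * w + S * (Lphi' / (2 * s))) -
   (Lphi * w * (2 * s)^-1 + K * (4 * s ^+ 2)^-1) = S * Lphi' * (4 * s ^+ 2)^-1.
  by rewrite /K; field; exact: lt0r_neq0.
by rewrite !mulr_ge0// invr_ge0 mulr_ge0// sqr_ge0.
Qed.
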